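(* There is an absolute constant $C>0$ such that the following holds. For all $\varepsilon\in(0,1)$, $\delta\in(0,1/2]$, and all $n,D\in\mathbb{N}$, there exists an $(\varepsilon,\delta)$-LNDP algorithm $\mathcal{A}$ on $n$-node graphs such that for every graph $G$ on node set $[n]$ with maximum degree at most $D$, having $m$ edges, \[ \mathbb{E}\big[|\mathcal{A}(G)-m|\big]\le C\,(D\sqrt{n}+n)\cdot\frac{\sqrt{\log(1/\delta)}}{\varepsilon}. \] (The algorithm is private for all graphs on $[n]$; only accuracy uses the degree bound.)
   Context: Graphs are simple and undirected on node set $[n]=\{1,\dots,n\}$; $N_i^G$ is the neighborhood of node $i$ in $G$ and $d_i=|N_i^G|$ its degree. Two graphs $G,G'$ on $[n]$ are node neighbors if they differ only in edges incident to a single node. Random variables $R_1,R_2$ on a common outcome space are $(\varepsilon,\delta)$-indistinguishable if for every measurable event $Y$, $\Pr[R_1\in Y]\le e^{\varepsilon}\Pr[R_2\in Y]+\delta$ and $\Pr[R_2\in Y]\le e^{\varepsilon}\Pr[R_1\in Y]+\delta$. An algorithm $\mathcal{A}$ on $n$-node graphs is (noninteractive) $(\varepsilon,\delta)$-LNDP if there exist a distribution over public random strings $\rho$, local randomizers $\mathcal{R}_{1,\rho},\dots,\mathcal{R}_{n,\rho}$ (randomized maps, run with independent internal randomness), and a postprocessing algorithm $\mathcal{P}$ such that $\mathcal{A}(G)=\mathcal{P}(\mathcal{R}_{1,\rho}(N_1^G),\dots,\mathcal{R}_{n,\rho}(N_n^G))$ with $\rho$ drawn from the public distribution, and for every fixed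 $\rho$ and every pair of node-neighboring graphs $G,G'$ on $[n]$ the vectors $(\mathcal{R}_{i,\rho}(N_i^G))_{i\in[n]}$ and $(\mathcal{R}_{i,\rho}(N_i^{G'}))_{i\in[n]}$ are $(\varepsilon,\delta)$-indistinguishable. *)

(* Defs.v *)
From HB Require Import structures.
From mathcomp Require Import all_boot all_order all_algebra.
From mathcomp Require Import all_classical all_reals all_analysis measurable_realfun.
Set Implicit Arguments. Unset Strict Implicit. Unset Printing Implicit Defensive.
Import Order.TTheory GRing.Theory Num.Theory.
Local Open Scope ring_scope.
Local Open Scope classical_set_scope.

Definition is_simple_graph (n : nat) (e : rel 'I_n) : Prop :=
  symmetric e /\ irreflexive e.

Definition nbhd (n : nat) (e : rel 'I_n) (i : 'I_n) : {set 'I_n} :=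
  [set j | e i j].
Definition deg (n : nat) (e : rel 'I_n) (i : 'I_n) : nat := #|nbhd e i|.

Definition num_edges (n : nat) (e : rel 'I_n) : nat :=
  #|[set p : 'I_n * 'I_n | (p.1 < p.2)%N && e p.1 p.2]|.

Definition node_neighbors (n : nat) (e e' : rel 'I_n) : Prop :=
  exists v : 'I_n, forall i j : 'I_n, i != v -> j != v -> e i j = e' i j.

Definition indist (R : realType) (d : measure_display) (T : measurableType d)
  (eps delta : R) (mu nu : probability T R) : Prop :=
  forall Y : set T, measurable Y ->
    (mu Y <= (expR eps)%:E * nu Y + delta%:E)%E /\
    (nu Y <= (expR eps)%:E * mu Y + delta%:E)%E.

(* Q is the product (independent joint law) of the laws mu_i on n.-tuple M
   (with the product sigma-algebra): the product measure is the unique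
   probability measure whose value on every measurable box is the product
   of the marginal probabilities. *)
Definition is_product_prob (R : realType) (d : measure_display)
  (M : measurableType d) (n : nat) (mu : 'I_n -> probability M R)
  (Q : probability (n.-tuple M) R) : Prop :=
  forall A : 'I_n -> set M, (forall i, measurable (A i)) ->
    Q [set x | forall i, A i (tnth x i)] = (\prod_(i < n) fine (mu i (A i)))%:E.

(* A noninteractive (eps,delta)-LNDP algorithm on n-node graphs with real
   output, given by:
   - a probability space (Rho, Ppub) of public random strings,
   - local randomizers Rnd rho i : {set 'I_n} -> (law of the message in M),
     run with independent internal randomness: for a graph e, the message
     vector has law Q rho e, the product of the laws Rnd rho i (N_i^e),
   - a (measurable) postprocessing map Post from the message vector to R.
   The output A(G) is Post applied to a sample of Q rho G, rho ~ Ppub. *)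
Definition is_LNDP (R : realType) (n : nat) (eps delta : R)
  (dP : measure_display) (Rho : measurableType dP) (Ppub : probability Rho R)
  (dM : measure_display) (M : measurableType dM)
  (Rnd : Rho -> 'I_n -> {set 'I_n} -> probability M R)
  (Q : Rho -> rel 'I_n -> probability (n.-tuple M) R)
  (Post : n.-tuple M -> R) : Prop :=
  [/\ (forall rho e, is_simple_graph e ->
         is_product_prob (fun i => Rnd rho i (nbhd e i)) (Q rho e)),
      (forall rho e e', is_simple_graph e -> is_simple_graph e' ->
         node_neighbors e e' -> indist eps delta (Q rho e) (Q rho e')),
      measurable_fun setT Post &
      (forall e Y, measurable Y -> measurable_fun [set: Rho] ((fun rho => Q rho e Y) : Rho -> \bar R))].

Definition expected_abs_error (R : realType) (n : nat)
  (dP : measure_display) (Rho : measurableType dP) (Ppub : probability Rho R)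
  (dM : measure_display) (M : measurableType dM)
  (Q : Rho -> rel 'I_n -> probability (n.-tuple M) R)
  (Post : n.-tuple M -> R) (e : rel 'I_n) : \bar R :=
  (\int[Ppub]_rho \int[Q rho e]_y (`| Post y - (num_edges e)%:R | )%:E)%E.

(* Main.v *)
(* Node [i] releases [min(deg i, D)] plus Gaussian noise and the server halves
   the sum of the messages. Changing the edges at a node [v] moves the clipped
   degree of [v] by at most [D] and every other one by at most [1], so the
   vector of clipped degrees has squared L2-sensitivity at most [D^2 + n], and
   noise of variance [4 (D^2 + n) log(1/delta) / eps^2] suffices; the [n]
   independent noises then add up to a standard deviation of order
   [sqrt (n (D^2 + n) log(1/delta)) / eps]. For privacy, an exponential moment
   of the log-likelihood ratio, which is affine in each message, reduces to the
   moment generating function of the normal law; the same function gives the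
   error bound. *)
Require Import Defs.
From HB Require Import structures.
From mathcomp Require Import all_boot all_order all_algebra.
From mathcomp Require Import all_classical all_reals all_analysis measurable_realfun.
From mathcomp Require Import ring lra zify.
Import Order.TTheory GRing.Theory Num.Theory.
Local Open Scope ring_scope.

(** * Change of measure by a density *)

Section density.
Local Open Scope classical_set_scope.
Local Open Scope ereal_scope.
Context {R : realType} {d} {T : measurableType d}.
Variables (mu : {sigma_finite_measure set T -> \bar R})
          (nu : {finite_measure set T -> \bar R}) (g : T -> \bar R).
Hypotheses (g0 : forall x, 0 <= g x) (mg : measurable_fun setT g).
Hypothesis nuE : forall A, measurable A -> nu A = \int[mu]_(x in A) g x.

(** The density formula makes [nu] absolutely continuous with respect to [mu]. Its Radon-Nikodym
    derivative and [g] have the same integral over every measurable set, so they agree almost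
    everywhere and the change of variables for the former transfers to [g]. *)
Lemma ge0_integral_density (f : T -> \bar R) :
  (forall x, 0 <= f x) -> measurable_fun setT f ->
  \int[nu]_x f x = \int[mu]_x (f x * g x).
Proof.
move=> f0 mf.
have numu : nu `<< mu.
  apply/null_content_dominatesP => A mA muA0; rewrite nuE//.
  by apply: null_set_integral => //; exact: measurable_funTS.
rewrite -(Radon_Nikodym_SigmaFinite.change_of_variables numu)//.
have iRN := Radon_Nikodym_SigmaFinite.f_integrable numu.
apply: ae_eq_integral => //.
- by apply: emeasurable_funM => //; exact: measurable_int iRN.
- exact: emeasurable_funM.
apply: ae_eqe_mul2l.
apply: integral_ae_eq => // A _ mA.
by rewrite -Radon_Nikodym_SigmaFinite.f_integral// nuE.
Qed.

End density.

(** * Finite products of probability laws, carried by tuples *)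

Section tuple_product.
Local Open Scope classical_set_scope.
Local Open Scope ereal_scope.
Context {R : realType} {d} {T : measurableType d}.

Definition pair_cons n (p : T * n.-tuple T) : n.+1.-tuple T :=
  [the n.+1.-tuple T of p.1 :: p.2].

Lemma measurable_pair_cons n : measurable_fun setT (pair_cons n).
Proof. exact: (measurable_cons measurable_fst measurable_snd). Qed.

HB.instance Definition _ n :=
  isMeasurableFun.Build _ _ _ _ (pair_cons n) (measurable_pair_cons n).

Definition cons_prob n (P : probability T R) (Q : probability (n.-tuple T) R)
  : probability (n.+1.-tuple T) R :=
  distribution (P \x Q : probability _ R) (pair_cons n).

(** Built one coordinate at a time, as the image under cons of the binary product of the first law
    and the product of the rest, so that Tonelli and induction on [n] compute integrals. *)
Fixpoint tuple_prob n : ('I_n -> probability T R) -> probability (n.-tuple T) R :=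
  match n with
  | 0 => fun=> \d_([tuple] : 0.-tuple T)
  | n'.+1 => fun P => cons_prob n' (P ord0) (tuple_prob n' (P \o lift ord0))
  end.

Lemma integral_tuple_prob0 (P : 'I_0 -> probability T R)
    (F : 0.-tuple T -> \bar R) :
  measurable_fun setT F -> \int[tuple_prob 0 P]_x F x = F [tuple].
Proof. by move=> mF; rewrite integral_dirac// diracT mul1e. Qed.

Lemma measurable_tuple_cons n (x : T) (F : n.+1.-tuple T -> \bar R) :
  measurable_fun setT F -> measurable_fun setT (fun t => F (pair_cons n (x, t))).
Proof.
move=> mF; apply: (measurableT_comp mF).
exact: (measurableT_comp (measurable_pair_cons n) (pair1_measurable x)).
Qed.

Lemma integral_tuple_probS n (P : 'I_n.+1 -> probability T R)
    (F : n.+1.-tuple T -> \bar R) :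
  measurable_fun setT F -> (forall x, 0 <= F x) ->
  \int[tuple_prob n.+1 P]_x F x =
  \int[P ord0]_x \int[tuple_prob n (P \o lift ord0)]_t F (pair_cons n (x, t)).
Proof.
move=> mF F0; rewrite ge0_integral_distribution// fubini_tonelli1//=.
by apply: (measurableT_comp mF); exact: measurable_pair_cons.
Qed.

Lemma measurable_integral_tuple_cons n (Q : probability (n.-tuple T) R)
    (F : n.+1.-tuple T -> \bar R) :
  measurable_fun setT F -> (forall x, 0 <= F x) ->
  measurable_fun setT (fun x => \int[Q]_t F (pair_cons n (x, t))).
Proof.
move=> mF F0.
apply: (@measurable_fun_fubini_tonelli_F _ _ _ _ _ Q (F \o pair_cons n)) => //.
- by apply: (measurableT_comp mF); exact: measurable_pair_cons.
- by move=> x; exact: F0.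
Qed.

Lemma measurable_prod_tnth n (f : 'I_n -> T -> R) :
  (forall i, measurable_fun setT (f i)) ->
  measurable_fun setT (fun x : n.-tuple T => \prod_(i < n) f i (tnth x i))%R.
Proof.
move=> mf; apply: measurable_prod => i _.
by apply: measurableT_comp => //; exact: measurable_tnth.
Qed.

Lemma prod_tnth_cons n (f : 'I_n.+1 -> T -> R) x (t : n.-tuple T) :
  (\prod_(i < n.+1) f i (tnth (pair_cons n (x, t)) i) =
   f ord0 x * \prod_(i < n) f (lift ord0 i) (tnth t i))%R.
Proof. by rewrite big_ord_recl tnth0; under eq_bigr do rewrite tnthS. Qed.

(** Independence for nonnegative factors: Tonelli isolates the head, whose factor is constant in the
    inner integral. Box probabilities and moment generating functions both follow from it. *)
Lemma integral_tuple_prob_prod n (P : 'I_n -> probability T R) (f : 'I_n -> T -> R) :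
  (forall i, measurable_fun setT (f i)) -> (forall i x, (0 <= f i x)%R) ->
  \int[tuple_prob n P]_x (\prod_(i < n) f i (tnth x i))%:E =
  \prod_(i < n) \int[P i]_x (f i x)%:E.
Proof.
elim: n P f => [|n IH] P f mf f0.
  rewrite integral_tuple_prob0 ?big_ord0//.
  by apply/measurable_EFinP; exact: measurable_prod_tnth.
rewrite integral_tuple_probS; first last.
- by move=> x; rewrite lee_fin prodr_ge0.
- by apply/measurable_EFinP; exact: measurable_prod_tnth.
have mp : measurable_fun setT (fun t : n.-tuple T =>
    (\prod_(i < n) f (lift ord0 i) (tnth t i))%:E).
  by apply/measurable_EFinP; exact: (measurable_prod_tnth n (fun i => f (lift ord0 i))).
have p0 (t : n.-tuple T) : 0 <= (\prod_(i < n) f (lift ord0 i) (tnth t i))%:E.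
  by rewrite lee_fin prodr_ge0.
rewrite big_ord_recl -IH//.
under eq_integral => x _.
  under eq_integral => t _ do rewrite prod_tnth_cons EFinM.
  rewrite ge0_integralZl//; last by rewrite lee_fin.
  over.
rewrite ge0_integralZr//; first exact/measurable_EFinP.
- by move=> x _; rewrite lee_fin.
- exact: integral_ge0.
Qed.

(** The indicator of a box is the product of the indicators of its sides, so the previous
    factorization applies. *)
Lemma is_product_tuple_prob n (P : 'I_n -> probability T R) :
  is_product_prob P (tuple_prob n P).
Proof.
move=> A mA; set B := [set x | _].
have BE x : (\1_B x = \prod_(i < n) \1_(A i) (tnth x i) :> R)%R.
  rewrite indicE; case: (boolP (x \in B)) => [/set_mem Bx|xB].
    by rewrite big1// => i _; rewrite indicE mem_set.
  apply/esym/eqP; rewrite prodf_seq_eq0; apply/hasP.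
  apply: contrapT => h; move/negP: xB; apply; apply/mem_set => i.
  apply: contrapT => nA; apply: h; exists i; first exact: mem_index_enum.
  by rewrite /= indicE memNset.
have mB : measurable B.
  have -> : B = \bigcap_(i in [set: 'I_n]) ((fun x : n.-tuple T => tnth x i) @^-1` A i).
    by apply/seteqP; split => [x Bx i _|x Bx i]; apply: Bx.
  apply: fin_bigcap_measurable => // i _.
  by rewrite -[X in measurable X]setTI; exact: measurable_tnth.
transitivity (\int[tuple_prob n P]_x (\1_B x)%:E); first by rewrite integral_indic// setIT.
under eq_integral do rewrite BE.
rewrite (integral_tuple_prob_prod n P (fun i => \1_(A i)))//.
rewrite -prodEFin; apply: eq_bigr => i _.
by rewrite integral_indic// setIT fineK// fin_num_measure.
Qed.

(** Densities tensorize: the law of the head is changed first, then the induction hypothesis changes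
    the laws of the tail. *)
Lemma integral_tuple_prob_density n (P Q : 'I_n -> probability T R)
    (g : 'I_n -> T -> R) :
  (forall i, measurable_fun setT (g i)) -> (forall i x, (0 <= g i x)%R) ->
  (forall i (f : T -> \bar R), measurable_fun setT f -> (forall x, 0 <= f x) ->
     \int[P i]_x f x = \int[Q i]_x (f x * (g i x)%:E)) ->
  forall F : n.-tuple T -> \bar R,
    measurable_fun setT F -> (forall x, 0 <= F x) ->
  \int[tuple_prob n P]_x F x =
  \int[tuple_prob n Q]_x (F x * (\prod_(i < n) g i (tnth x i))%:E).
Proof.
move=> + + + F; elim: n P Q g F => [|n IH] P Q g F mg g0 PQ mF F0.
  rewrite !integral_tuple_prob0 ?big_ord0 ?mule1//.
  apply: emeasurable_funM => //.
  by apply/measurable_EFinP; exact: measurable_prod_tnth.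
have mp m (h : 'I_m -> T -> R) : (forall i, measurable_fun setT (h i)) ->
    measurable_fun setT (fun t : m.-tuple T => (\prod_(i < m) h i (tnth t i))%:E).
  by move=> mh; apply/measurable_EFinP; exact: measurable_prod_tnth.
rewrite !integral_tuple_probS//; first last.
- by move=> x; rewrite mule_ge0// lee_fin prodr_ge0.
- by apply: emeasurable_funM => //; exact: mp.
rewrite PQ; first last.
- by move=> x; apply: integral_ge0.
- exact: measurable_integral_tuple_cons.
apply: eq_integral => x _.
rewrite (IH _ (Q \o lift ord0) (fun i => g (lift ord0 i)))//; first last.
- exact: measurable_tuple_cons.
- by move=> i; exact: PQ.
rewrite -ge0_integralZr//; first last.
- by rewrite lee_fin.
- by move=> t _; rewrite mule_ge0// lee_fin prodr_ge0.
- by apply: emeasurable_funM; [exact: measurable_tuple_cons|exact: (mp n (fun i => g (lift ord0 i)))].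
by apply: eq_integral => t _; rewrite prod_tnth_cons EFinM muleAC -!muleA.
Qed.

End tuple_product.

(** * Likelihood ratios and exponential moments of normal laws *)

Section normal_moments.
Context {R : realType}.
Implicit Types (m s a b x : R) (f : measurableTypeR R -> \bar R).

Lemma integral_normal_prob m s f :
  measurable_fun setT f -> (forall x, 0 <= f x)%E ->
  (\int[normal_prob m s]_x f x =
   \int[lebesgue_measure]_x (f x * (normal_pdf m s x)%:E))%E.
Proof.
move=> mf f0.
apply: (ge0_integral_density lebesgue_measure (normal_prob m s)
  (fun x => (normal_pdf m s x)%:E)) => //.
by apply/measurable_EFinP; exact: measurable_normal_pdf.
Qed.

(** The logarithm of the ratio of the normal densities with means [a] and [b] and common deviation
    [s]. *)
Definition normal_llr a b s x : R := ((x - b) ^+ 2 - (x - a) ^+ 2) / (s ^+ 2 *+ 2).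

Lemma measurable_normal_llr a b s : measurable_fun setT (normal_llr a b s).
Proof.
apply: measurable_funM => //; apply: measurable_funB;
  by apply: measurable_funX; exact: measurable_funB.
Qed.

Lemma normal_pdf_llr a b s x : s != 0 ->
  normal_pdf a s x = expR (normal_llr a b s x) * normal_pdf b s x.
Proof.
move=> s0; rewrite !normal_pdfE// /normal_fun mulrCA -expRD.
by congr (_ * expR _); rewrite /normal_llr !mulNr mulrBl; ring.
Qed.

Lemma integral_normal_prob_llr a b s f : s != 0 ->
  measurable_fun setT f -> (forall x, 0 <= f x)%E ->
  (\int[normal_prob a s]_x f x =
   \int[normal_prob b s]_x (f x * (expR (normal_llr a b s x))%:E))%E.
Proof.
move=> s0 mf f0; rewrite !integral_normal_prob//.
- by apply: eq_integral => x _; rewrite (normal_pdf_llr a b)// EFinM muleA.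
- apply: emeasurable_funM => //; apply/measurable_EFinP.
  by apply: measurableT_comp => //; exact: measurable_normal_llr.
- by move=> x; rewrite mule_ge0// lee_fin expR_ge0.
Qed.

(** Completing the square turns the tilted density into a constant times the normal density centred
    at [m + a * s ^+ 2]. *)
Lemma normal_mgf m s a : s != 0 ->
  (\int[normal_prob m s]_x (expR (a * (x - m)))%:E =
   (expR (a ^+ 2 * s ^+ 2 / 2))%:E)%E.
Proof.
move=> s0; rewrite integral_normal_prob//; last first.
  apply/measurable_EFinP; apply: measurableT_comp => //.
  by apply: measurable_funM => //; exact: measurable_funB.
under eq_integral => x _.
  have -> : ((expR (a * (x - m)))%:E * (normal_pdf m s x)%:E =
     (expR (a ^+ 2 * s ^+ 2 / 2))%:E * (normal_pdf (m + a * s ^+ 2) s x)%:E)%E.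
    rewrite -!EFinM !normal_pdfE// /normal_fun !(mulrCA (expR _)) -!expRD.
    by congr (_ * expR _)%:E; field.
  over.
rewrite ge0_integralZl//.
- by rewrite integral_normal_pdf mule1.
- by apply/measurable_EFinP; exact: measurable_normal_pdf.
- by move=> x _; rewrite lee_fin normal_pdf_ge0.
Qed.

(** The squares of [x] cancel in [normal_llr], so up to a constant factor this is the moment
    generating function at the slope [c]. The exponent is [l] times the Rényi divergence of order
    [1 + l]. *)
Lemma normal_llr_moment a b s l : s != 0 ->
  (\int[normal_prob b s]_x (expR ((1 + l) * normal_llr a b s x))%:E =
   (expR (l * (1 + l) * (a - b) ^+ 2 / (s ^+ 2 *+ 2)))%:E)%E.
Proof.
move=> s0; pose c := (1 + l) * (a - b) / s ^+ 2.
under eq_integral => x _.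
  have -> : (expR ((1 + l) * normal_llr a b s x))%:E =
    ((expR (- ((1 + l) * (a - b) ^+ 2 / (s ^+ 2 *+ 2))))%:E
     * (expR (c * (x - b)))%:E)%E.
    by rewrite -EFinM -expRD /c /normal_llr; congr (expR _)%:E; field.
  over.
rewrite ge0_integralZl//.
- by rewrite normal_mgf// -EFinM -expRD /c; congr (expR _)%:E; field.
- apply/measurable_EFinP; apply: measurableT_comp => //.
  by apply: measurable_funM => //; exact: measurable_funB.
Qed.

End normal_moments.

(** * From moments of the log-likelihood ratio to indistinguishability *)

Section indistinguishability.
Local Open Scope classical_set_scope.
Context {R : realType}.

(* Chernoff on the log-likelihood ratio [h]: pointwise,
   [e^h <= e^eps + e^((1+l)h - l eps)], according to whether [h <= eps]. *)
Lemma le_prob_llr_moment {d} {T : measurableType d} (P Q : probability T R)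
    (h : T -> R) (eps delta l : R) (Y : set T) :
  0 <= l -> measurable_fun setT h -> measurable Y ->
  (P Y = \int[Q]_x ((\1_Y x)%:E * (expR (h x))%:E))%E ->
  (\int[Q]_x (expR ((1 + l) * h x))%:E <= (expR (l * eps) * delta)%:E)%E ->
  (P Y <= (expR eps)%:E * Q Y + delta%:E)%E.
Proof.
move=> l0 mh mY -> hl.
have mi : measurable_fun setT (fun x => (\1_Y x : R)%:E).
  by apply/measurable_EFinP.
have mX : measurable_fun setT (fun x => (expR ((1 + l) * h x))%:E).
  apply/measurable_EFinP; apply: measurableT_comp => //.
  exact: measurable_funM.
apply: (@le_trans _ _ (\int[Q]_x ((expR eps)%:E * (\1_Y x)%:E +
    (expR (- (l * eps)))%:E * (expR ((1 + l) * h x))%:E))%E).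
  apply: ge0_le_integral => //.
  - apply: emeasurable_funM => //; apply/measurable_EFinP.
    exact: measurableT_comp.
  - by apply: emeasurable_funD; exact: measurable_funeM.
  - move=> x _; rewrite -!EFinM -EFinD lee_fin indicE.
    case: (x \in Y) => /=; last by rewrite mul0r mulr0 add0r -expRD expR_ge0.
    rewrite mul1r mulr1 -expRD; have [hx|hx] := lerP (h x) eps.
      by apply: ler_wpDr; rewrite ?expR_ge0// ler_expR.
    apply: ler_wpDl; rewrite ?expR_ge0// ler_expR.
    have : 0 <= l * (h x - eps) by rewrite mulr_ge0// subr_ge0 ltW.
    lra.
rewrite ge0_integralD//=; first last.
- exact: measurable_funeM.
- exact: measurable_funeM.
rewrite !ge0_integralZl ?lee_fin ?expR_ge0//.
rewrite integral_indic// setIT; apply: leeD => //.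
apply: (@le_trans _ _ ((expR (- (l * eps)))%:E * (expR (l * eps) * delta)%:E)%E).
  by rewrite lee_wpmul2l// lee_fin expR_ge0.
by rewrite -EFinM mulrA -expRD addNr expR0 mul1r.
Qed.

(** Log-likelihood ratios of independent coordinates add up, so the moment factors; with a common
    [s] it depends on the means only through their squared L2 distance. *)
Lemma le_normal_tuple_prob n (a b : 'I_n -> R) (s eps delta l : R)
    (Y : set (n.-tuple (measurableTypeR R))) :
  s != 0 -> 0 <= l -> measurable Y ->
  expR (l * (1 + l) * (\sum_(i < n) (a i - b i) ^+ 2) / (s ^+ 2 *+ 2))
    <= expR (l * eps) * delta ->
  (tuple_prob n (fun i => normal_prob (a i) s) Y <=
   (expR eps)%:E * tuple_prob n (fun i => normal_prob (b i) s) Y + delta%:E)%E.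
Proof.
move=> s0 l0 mY hs; set P := tuple_prob n _; set Q := tuple_prob n _.
pose h (x : n.-tuple (measurableTypeR R)) :=
  \sum_(i < n) normal_llr (a i) (b i) s (tnth x i).
have mllr i : measurable_fun setT (normal_llr (a i) (b i) s).
  exact: measurable_normal_llr.
have mexp (c : R) i : measurable_fun setT (fun x => expR (c * normal_llr (a i) (b i) s x)).
  by apply: measurableT_comp => //; exact: measurable_funM.
apply: (le_prob_llr_moment P Q h eps delta l) => //.
- apply: measurable_sum => i.
  exact: (measurableT_comp (mllr i) (measurable_tnth i)).
- transitivity (\int[P]_x (\1_Y x)%:E)%E; first by rewrite integral_indic// setIT.
  have g0 i (x : measurableTypeR R) : 0 <= expR (normal_llr (a i) (b i) s x).
    exact: expR_ge0.
  have mg i : measurable_fun setT (fun x => expR (normal_llr (a i) (b i) s x)).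
    exact: measurableT_comp.
  have mY1 : measurable_fun setT (fun x : n.-tuple (measurableTypeR R) => (\1_Y x : R)%:E).
    exact/measurable_EFinP.
  have Y10 (x : n.-tuple (measurableTypeR R)) : (0 <= (\1_Y x : R)%:E)%E by rewrite lee_fin.
  rewrite [LHS](integral_tuple_prob_density n (fun i => normal_prob (a i) s)
    (fun i => normal_prob (b i) s) _ mg g0
    (fun i f mf f0 => integral_normal_prob_llr (a i) (b i) s f s0 mf f0) _ mY1 Y10).
  by apply: eq_integral => x _; rewrite /h expR_sum.
under eq_integral do rewrite mulr_sumr expR_sum.
rewrite /Q (integral_tuple_prob_prod n (fun i => normal_prob (b i) s)
  _ (mexp _) (fun=> fun=> expR_ge0 _)).
under eq_bigr do rewrite normal_llr_moment//.
by rewrite prodEFin -expR_sum lee_fin -mulr_suml -mulr_sumr.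
Qed.

End indistinguishability.

(** * Mean absolute value of a sum of independent centred normals *)

Section accuracy.
Local Open Scope classical_set_scope.
Context {R : realType}.
Implicit Types (n : nat) (s : R).

Lemma measurable_sum_tnthB n (a : 'I_n -> R) :
  measurable_fun setT
    (fun x : n.-tuple (measurableTypeR R) => \sum_(i < n) (tnth x i - a i)).
Proof.
apply: measurable_sum => i; apply: measurable_funB => //.
exact: measurable_tnth.
Qed.

Lemma normal_tuple_prob_mgf n (a : 'I_n -> R) s c : s != 0 ->
  (\int[tuple_prob n (fun i => normal_prob (a i) s)]_x
     (expR (c * \sum_(i < n) (tnth x i - a i)))%:E =
   (expR (n%:R * (c ^+ 2 * s ^+ 2 / 2)))%:E)%E.
Proof.
move=> s0; under eq_integral do rewrite mulr_sumr expR_sum.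
have me i : measurable_fun setT (fun x : measurableTypeR R => expR (c * (x - a i))).
  apply: measurableT_comp => //; apply: measurable_funM => //.
  exact: measurable_funB.
rewrite (integral_tuple_prob_prod n (fun i => normal_prob (a i) s) _ me
  (fun=> fun=> expR_ge0 _)).
under eq_bigr do rewrite normal_mgf//.
by rewrite prodEFin -expR_sum sumr_const card_ord mulr_natl.
Qed.

Lemma expR_half_le2 : expR 2^-1 <= 2 :> R.
Proof.
have := expR_ge1Dx (- (2^-1 : R)); rewrite expRN => h.
by rewrite -lef_pV2 ?posrE ?expR_gt0//; lra.
Qed.

(** Since the square root of [e] is at most [2], hence at most [delta^-1]. This bound later lets the
    logarithm absorb [eps]. *)
Lemma half_le_ln_inv (delta : R) : 0 < delta <= 2^-1 -> 2^-1 <= ln (delta^-1).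
Proof.
move=> /andP[d0 d2]; rewrite -[leLHS]expRK ler_ln ?posrE ?expR_gt0 ?invr_gt0//.
by rewrite (le_trans expR_half_le2)// -[leLHS]invrK lef_pV2 ?posrE ?invr_gt0//.
Qed.

(* [|S| <= (e^(tS) + e^(-tS)) / t], with [t] the inverse of the standard
   deviation of [S]. *)
Lemma normal_tuple_prob_abs n (a : 'I_n -> R) s : (0 < n)%N -> 0 < s ->
  (\int[tuple_prob n (fun i => normal_prob (a i) s)]_x
     `| \sum_(i < n) (tnth x i - a i) |%:E <= (4 * (s * Num.sqrt n%:R))%:E)%E.
Proof.
move=> n0 s0; set P := tuple_prob n _.
have n0' : 0 < n%:R :> R by rewrite ltr0n.
pose r : R := s * Num.sqrt n%:R; have r0 : 0 < r by rewrite mulr_gt0// sqrtr_gt0.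
have r0W := ltW r0; have n0W := ltW n0'.
pose S (x : n.-tuple (measurableTypeR R)) := \sum_(i < n) (tnth x i - a i).
have mS : measurable_fun setT S by exact: measurable_sum_tnthB.
have mE c : measurable_fun setT (fun x => (r * expR (c * S x))%:E).
  apply/measurable_EFinP; apply: measurable_funM => //.
  by apply: measurableT_comp => //; exact: measurable_funM.
(* For [c] equal to plus or minus [r^-1] the exponent of the generating function is exactly [2^-1].
   Each of the two terms is thus at most [2 * r], whence the factor [4]. *)
have mgf c : c ^+ 2 = (r ^+ 2)^-1 ->
    (\int[P]_x (r * expR (c * S x))%:E <= (r * 2)%:E)%E.
  move=> cr; under eq_integral do rewrite EFinM.
  rewrite ge0_integralZl_EFin //; last first.
    apply/measurable_EFinP; apply: measurableT_comp => //.
    exact: measurable_funM.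
  rewrite normal_tuple_prob_mgf ?gt_eqF// -EFinM lee_fin ler_pM2l//.
  rewrite (_ : _ * _ = 2^-1) ?expR_half_le2// cr /r exprMn sqr_sqrtr//.
  by field; rewrite !gt_eqF.
apply: (@le_trans _ _ (\int[P]_x
    ((r * expR (r^-1 * S x))%:E + (r * expR (- r^-1 * S x))%:E))%E).
  apply: ge0_le_integral => //.
  - by apply/measurable_EFinP; exact: measurableT_comp.
  - exact: emeasurable_funD.
  - move=> x _; rewrite -EFinD lee_fin -/(S x) -mulrDr -ler_pdivrMl//.
    have h (y : R) : `|y| <= expR y + expR (- y).
      have := expR_ge1Dx y; have := expR_ge1Dx (- y).
      have := expR_ge0 y; have := expR_ge0 (- y).
      by case: (ger0P y) => _; lra.
    by have := h (r^-1 * S x); rewrite normrM mulNr gtr0_norm ?invr_gt0.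
rewrite ge0_integralD//=; first last.
- by move=> x _; rewrite lee_fin mulr_ge0 ?expR_ge0 ?ltW.
- by move=> x _; rewrite lee_fin mulr_ge0 ?expR_ge0 ?ltW.
rewrite (_ : 4 * _ = r * 2 + r * 2); last by rewrite -/r; ring.
by rewrite EFinD leeD// mgf// ?sqrrN exprVn.
Qed.

End accuracy.

(** * Degree sums and sensitivity of clipped degrees *)

Section graphs.
Variable n : nat.
Implicit Types e : rel 'I_n.

(* The comprehension in [num_edges] is a classical set, this one a [{set _}]. *)
Lemma num_edgesE e :
  num_edges e = #|[set p : 'I_n * 'I_n | (p.1 < p.2)%N && e p.1 p.2]|.
Proof.
apply: eq_card => p; rewrite [RHS]inE.
by apply/idP/idP => [/set_mem|pe]//; exact/mem_set.
Qed.

(** Handshake identity: the degrees count adjacent ordered pairs. Swapping matches increasing pairs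
    with decreasing ones, and irreflexivity rules out the diagonal. *)
Lemma sum_deg e : is_simple_graph e -> (\sum_i deg e i = (num_edges e).*2)%N.
Proof.
move=> [esym eirr].
have -> : (\sum_i deg e i = #|[set p : 'I_n * 'I_n | e p.1 p.2]|)%N.
  rewrite -sum1dep_card (eq_bigr (fun i => \sum_(j | e i j) 1)%N); last first.
    by move=> i _; rewrite sum1dep_card.
  by rewrite pair_big_dep.
have E : num_edges e = #|[set p : 'I_n * 'I_n | (p.2 < p.1)%N && e p.1 p.2]|.
  have swapK : involutive (fun p : 'I_n * 'I_n => (p.2, p.1)) by case.
  rewrite num_edgesE -(card_imset _ (inv_inj swapK)).
  apply: eq_card => -[i j]; apply/imsetP/idP.
  - by move=> [[k l]]; rewrite !inE/= => /andP[kl ekl] [-> ->]; rewrite kl esym.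
  - by rewrite inE/= => /andP[ij eij]; exists (j, i); rewrite // inE/= ij esym.
rewrite -addnn {2}E num_edgesE -cardsUI [X in (_ + X)%N](_ : _ = 0%N) ?addn0.
- apply: eq_card => -[i j]; rewrite !inE/= -andb_orl.
  by case: ltngtP => //= /val_inj ->; rewrite eirr.
- apply: eq_card0 => -[i j]; rewrite !inE/=.
  by case: ltngtP; rewrite /= ?andbF.
Qed.

(** Once [v] is removed, the two neighborhoods of [i] coincide. *)
Lemma deg_neighbors e e' v i :
  (forall i j, i != v -> j != v -> e i j = e' i j) -> i != v ->
  (deg e i <= (deg e' i).+1)%N.
Proof.
move=> ee' iv; rewrite /deg (cardsD1 v) [in leqRHS](cardsD1 v).
have -> : (nbhd e i :\ v = nbhd e' i :\ v)%SET.
  by apply/setP => j; rewrite !inE; case: eqVneq => //= jv; rewrite ee'.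
by rewrite -addSn leq_add2r (leq_trans (leq_b1 _)).
Qed.

Lemma sum_sqr_clipped_degB_le (R : realType) (D : nat) e e' : node_neighbors e e' ->
  \sum_i ((minn (deg e i) D)%:R - (minn (deg e' i) D)%:R) ^+ 2
    <= D%:R ^+ 2 + n%:R :> R.
Proof.
move=> [v ee'].
have sqr_le (a b c : nat) : (a <= b + c -> b <= a + c ->
    (a%:R - b%:R) ^+ 2 <= c%:R ^+ 2 :> R)%N.
  rewrite -!(ler_nat R) !natrD => ab ba; rewrite -[leLHS]real_normK ?num_real//.
  by rewrite lerXn2r ?nnegrE// ler_norml; lra.
(* At [v] both clipped degrees lie between [0] and [D]; elsewhere clipping preserves the bound [1]
   on the change of degree. *)
rewrite (bigD1 v)//= lerD//; first by apply: sqr_le; lia.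
rewrite (@le_trans _ _ (\sum_(i < n | i != v) 1))//.
  apply: ler_sum => i iv.
  have h1 := deg_neighbors e e' v i ee' iv.
  have h2 := deg_neighbors e' e v i (fun i j hi hj => esym (ee' i j hi hj)) iv.
  by rewrite -[leRHS](expr1n _ 2) (sqr_le _ _ 1%N)//; lia.
by rewrite sumr_const ler_nat (leq_trans (max_card _))// card_ord.
Qed.

End graphs.

(** * The Gaussian degree mechanism: calibration, privacy and error *)

Section mechanism.
Context {R : realType}.
Variables (eps delta : R) (n D : nat).
Hypotheses (eps01 : 0 < eps < 1) (delta0 : 0 < delta <= 2^-1).

Definition noise_sd : R :=
  2 * Num.sqrt (D%:R ^+ 2 + n%:R) * Num.sqrt (ln delta^-1) / eps.

Definition degree_law (S : {set 'I_n}) : probability (measurableTypeR R) R :=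
  normal_prob (minn #|S| D)%:R noise_sd.

Definition degree_laws (e : rel 'I_n) : probability (n.-tuple (measurableTypeR R)) R :=
  tuple_prob n (fun i => degree_law (nbhd e i)).

Lemma noise_sd_gt0 : (0 < n)%N -> 0 < noise_sd.
Proof.
move=> n0; have L := half_le_ln_inv delta delta0; have /andP[e0 _] := eps01.
rewrite !mulr_gt0 ?invr_gt0 ?sqrtr_gt0//; last by lra.
by rewrite ltr_wpDl ?sqr_ge0// ltr0n.
Qed.

Lemma indist_degree_laws e e' : node_neighbors e e' ->
  indist eps delta (degree_laws e) (degree_laws e').
Proof.
move=> ee' Y mY.
have e'e : node_neighbors e' e by case: ee' => v h; exists v => i j iv jv; rewrite h.
(* The node witnessing neighborhood makes [n] positive, hence the noise nondegenerate. *)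
have n0 : (0 < n)%N by case: ee' => v _; exact: leq_ltn_trans (leq0n v) (ltn_ord v).
have s0 := noise_sd_gt0 n0; have /andP[e0 e1] := eps01; have /andP[d0 _] := delta0.
have L2 := half_le_ln_inv delta delta0; pose L := ln delta^-1.
have L0 : 0 < L by rewrite /L; lra.
have V0 : 0 < D%:R ^+ 2 + n%:R :> R by rewrite ltr_wpDl ?sqr_ge0// ltr0n.
have sE : noise_sd ^+ 2 = 4 * (D%:R ^+ 2 + n%:R) * L / eps ^+ 2.
  by rewrite /noise_sd -/L !exprMn !sqr_sqrtr ?ltW// exprVn; ring.
(* The moment order is [l = 2 * L / eps]: then [l * eps = 2 * L], and with [delta = expR (- L)] the
   exponent to stay below is [L]. *)
have l0 : 0 <= 2 * L / eps by rewrite mulr_ge0 ?invr_ge0 ?mulr_ge0 ?ltW.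
have moment V : V <= D%:R ^+ 2 + n%:R ->
    expR (2 * L / eps * (1 + 2 * L / eps) * V / (noise_sd ^+ 2 *+ 2)) <=
    expR (2 * L / eps * eps) * delta.
  move=> hV; have -> : delta = expR (- L).
    by rewrite /L lnV ?posrE// opprK lnK.
  rewrite -expRD ler_expR.
  apply: (@le_trans _ _ (2 * L / eps * (1 + 2 * L / eps) * (D%:R ^+ 2 + n%:R) / (noise_sd ^+ 2 *+ 2))).
    rewrite ler_pM2r ?invr_gt0 ?pmulrn_lgt0 ?exprn_gt0//.
    by rewrite ler_wpM2l// mulr_ge0// addr_ge0.
  (* At the maximal sensitivity the exponent is [(eps + 2 * L) / 4], which is at most [L] because
     [eps < 1 <= 2 * L]. *)
  rewrite sE (_ : _ / _ = (eps + 2 * L) / 4).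
    by rewrite mulfVK ?gt_eqF// ler_pdivrMr//; rewrite -/L in L2; lra.
  by field; rewrite !gt_eqF.
by split; apply: (le_normal_tuple_prob _ _ _ _ _ _ _ _ _ l0) => //;
  rewrite ?gt_eqF//; apply: moment; exact: sum_sqr_clipped_degB_le.
Qed.

Lemma degree_laws_error e : is_simple_graph e -> (forall i, (deg e i <= D)%N) ->
  (\int[degree_laws e]_y `|(\sum_(i < n) tnth y i) / 2 - (num_edges e)%:R|%:E <=
   (4 * (D%:R * Num.sqrt n%:R + n%:R) * Num.sqrt (ln delta^-1) / eps)%:E)%E.
Proof.
move=> se eD; have /andP[e0 _] := eps01.
pose S (y : n.-tuple (measurableTypeR R)) : R :=
  \sum_(i < n) (tnth y i - (minn (deg e i) D)%:R).
(* Under the degree bound clipping changes nothing, so by the handshake identity the means add up to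
   twice the number of edges. *)
have SE y : `|(\sum_(i < n) tnth y i) / 2 - (num_edges e)%:R| = 2^-1 * `|S y|.
  rewrite -[X in X * `|_|]ger0_norm ?invr_ge0// -normrM; congr `|_|.
  rewrite /S sumrB; under [X in _ = _ * (_ - X)]eq_bigr do rewrite (minn_idPl (eD _)).
  by rewrite -natr_sum sum_deg// -muln2 natrM; field.
under eq_integral do rewrite SE EFinM.
rewrite ge0_integralZl_EFin//; last first.
  by apply/measurable_EFinP; apply: measurableT_comp => //; exact: measurable_sum_tnthB.
(* The empty graph is treated apart: its sum is empty, and [noise_sd] vanishes if [D] is also
   [0]. *)
case: (posnP n) => [n0|n0].
  rewrite integral0_eq ?mule0 ?lee_fin.
    by rewrite !mulr_ge0 ?addr_ge0 ?mulr_ge0 ?sqrtr_ge0 ?invr_ge0 ?(ltW e0).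
  move=> y _; rewrite /S big1 ?normr0// => i _.
  by exfalso; move: (leq_ltn_trans (leq0n i) (ltn_ord i)); rewrite [X in (_ < X)%N]n0.
have h := normal_tuple_prob_abs n (fun i => (minn (deg e i) D)%:R) noise_sd n0 (noise_sd_gt0 n0).
apply: (le_trans (lee_wpmul2l _ h)); first by rewrite lee_fin invr_ge0.
rewrite -EFinM lee_fin /noise_sd.
set q := Num.sqrt (ln _); set u := Num.sqrt (_ + _); set w := Num.sqrt n%:R.
(* Subadditivity of the square root gives [u <= D%:R + w], and [w ^+ 2] is [n%:R]. *)
have uw : u * w <= D%:R * w + n%:R.
  have w2 : w ^+ 2 = n%:R by rewrite sqr_sqrtr.
  have w0 : 0 <= w := sqrtr_ge0 _.
  have uDw : u <= D%:R + w.
    rewrite -[leRHS]ger0_norm ?addr_ge0// -sqrtr_sqr ler_wsqrtr//.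
    by rewrite sqrrD w2 lerD2r lerDl mulrn_wge0// mulr_ge0.
  by rewrite -w2 expr2 -mulrDl ler_wpM2r.
(* The constant is [2^-1] from halving, [4] from the absolute moment and [2] from [noise_sd]. *)
rewrite (_ : 2^-1 * _ = 4 * (u * w) * q / eps); last by field; rewrite gt_eqF.
by rewrite ler_pM2r ?invr_gt0// ler_wpM2r ?sqrtr_ge0// ler_wpM2l.
Qed.

End mechanism.

Theorem theorem3p3 (R : realType) :
  exists C : R, 0 < C /\
  forall (eps delta : R) (n D : nat),
    0 < eps < 1 -> 0 < delta <= 2^-1 ->
    exists (dP : measure_display) (Rho : measurableType dP)
           (Ppub : probability Rho R)
           (dM : measure_display) (M : measurableType dM)
           (Rnd : Rho -> 'I_n -> {set 'I_n} -> probability M R)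
           (Q : Rho -> rel 'I_n -> probability (n.-tuple M) R)
           (Post : n.-tuple M -> R),
      is_LNDP eps delta Ppub Rnd Q Post /\
      forall e : rel 'I_n, is_simple_graph e ->
        (forall i : 'I_n, (deg e i <= D)%N) ->
        (expected_abs_error Ppub Q Post e <=
           (C * (D%:R * Num.sqrt n%:R + n%:R) * Num.sqrt (ln (delta^-1)) / eps)%:E)%E.
Proof.
exists 4; split=> // eps delta n D eps01 delta0.
(* No public randomness is used: its space is a single point, so the outer integral is that of a
   constant. *)
exists _, unit, \d_tt, _, (measurableTypeR R),
  (fun _ _ => degree_law eps delta n D), (fun=> degree_laws eps delta n D),
  (fun y => (\sum_(i < n) tnth y i) / 2).
split.
  split.
  - by move=> _ e _; exact: is_product_tuple_prob.
  - by move=> _ e e' _ _; exact: indist_degree_laws.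
  - apply: measurable_funM => //; apply: measurable_sum => i.
    exact: measurable_tnth.
  - by move=> e Y mY; exact: measurable_cst.
move=> e se eD; apply: le_trans (degree_laws_error _ _ _ _ eps01 delta0 e se eD).
by rewrite /expected_abs_error integral_cst// [X in (_ * X)%E]probability_setT mule1.
Qed.
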